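(* Let $G$ be a weighted graph on a finite vertex set $V$ with $n=|V|$ and nonnegative edge weights, and let $C=(c_{vw})_{v,w\in V}$ be its edge-connectivity matrix. For $v\in V$ let $m(v)\coloneqq\max\{c_{vw} : w\in V\setminus\{v\}\}$ be the maximum off-diagonal entry in row $v$, and let $M\coloneqq\max\{c_{vw} : v,w\in V\}$ be the maximum entry of $C$. Then: (1) The matrix $C+\operatorname{diag}(m(v) : v\in V)$ is positive semidefinite. (2) The smallest eigenvalue of $C$ is $-M$. (3) The energy of $C$ is at most $2(n-1)M$, with equality if and only if $G$ is uniformly $M$-edge-connected.
   Context: The edge-connectivity matrix $C(G)$ of an undirected graph $G=(V,E)$ with nonnegative edge weights is the $V\times V$ matrix whose off-diagonal $v$-$w$ entry is the minimum total weight of an edge set whose removal disconnects $v$ and $w$; its diagonal entries are $0$. The energy of a real symmetric matrix with eigenvalues $\lambda_1,\dots,\lambda_n$ is $\sum_{i=1}^n|\lambda_i|$. A graph is uniformly $M$-edge-connected if $c_{vw}=M$ for all pairs of distinct vertices $v,w$ (i.e. $M$ is the maximum number/weight of edge-disjoint paths, equivalently the minimum cut value, between any two distinct vertices). *)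

(* Defs.v *)
From HB Require Import structures.
From mathcomp Require Import all_boot all_order all_algebra.
From mathcomp Require Import complex polyrcf.

Set Implicit Arguments.
Unset Strict Implicit.
Unset Printing Implicit Defensive.

Import Order.TTheory GRing.Theory Num.Theory.
Local Open Scope ring_scope.

(* Only the values of [weight] on [edges] are meaningful. *)
Record wgraph (R : realDomainType) (V : finType) := WGraph {
  edges : {set {set V}};
  weight : {set V} -> R;
  card_edge : forall e, e \in edges -> #|e| = 2;
  weight_ge0 : forall e, e \in edges -> 0 <= weight e
}.

Section EdgeConnectivity.
Variables (R : realDomainType) (V : finType) (G : wgraph R V).
Implicit Types (v w : V) (F : {set {set V}}).

Definition adj F : rel V := [rel x y | [set x; y] \in F].

Definition disconnects F v w :=
  (F \subset edges G) && ~~ connect (adj (edges G :\: F)) v w.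

Definition total_weight F : R := \sum_(e in F) weight G e.

(* For v != w the set of all edges disconnects v and w and has the largest
   total weight, so the default value of the minimum is harmless. *)
Definition edge_conn v w : R :=
  if v == w then 0
  else \big[Num.min/total_weight (edges G)]_(F | disconnects F v w)
         total_weight F.

(* Edge connectivities are nonnegative, so the default value 0 only matters
   for the empty maximum, which is thus taken to be 0. *)
Definition max_row v : R := \big[Num.max/0]_(w | w != v) edge_conn v w.

Definition max_conn : R := \big[Num.max/0]_(vw : V * V) edge_conn vw.1 vw.2.

Definition uniformly_edge_connected (k : R) :=
  forall v w, v != w -> edge_conn v w = k.

Definition conn_mx : 'M[R]_#|V| :=
  \matrix_(i, j) edge_conn (enum_val i) (enum_val j).

Definition max_row_mx : 'M[R]_#|V| := diag_mx (\row_i max_row (enum_val i)).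

End EdgeConnectivity.

Definition psdmx (R : realDomainType) n (A : 'M[R]_n) :=
  A^T = A /\ forall x : 'cV[R]_n, 0 <= (x^T *m A *m x) 0 0.

Definition smallest_eigenvalue (R : realFieldType) n (A : 'M[R]_n) (a : R) :=
  eigenvalue A a /\ forall b, eigenvalue A b -> a <= b.

(* Eigenvalues are counted with algebraic multiplicity; see [energyP]. *)
Definition energy (R : rcfType) n (A : 'M[R]_n) : R :=
  \sum_(a <- rootsR (char_poly A)) `|a| *+ mup a (char_poly A).

Lemma energy_split (R : rcfType) n (A : 'M[R]_n) (s : seq R) :
  char_poly A = \prod_(a <- s) ('X - a%:P) -> energy A = \sum_(a <- s) `|a|.
Proof.
move=> As; have A0 : char_poly A != 0 by rewrite monic_neq0 ?char_poly_monic.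
rewrite /energy.
have eq_s : perm_eq (rootsR (char_poly A)) (undup s).
  apply: uniq_perm; rewrite ?undup_uniq ?uniq_roots // => a.
  have /(_ a) := roots_on_rootsR A0; rewrite in_itv /= => <-.
  by rewrite mem_undup As root_prod_XsubC.
rewrite (perm_big _ eq_s) -[RHS](perm_big _ (perm_count_undup s)).
rewrite big_flatten big_map.
apply: eq_bigr => a _.
by rewrite As mu_prod_XsubC big_nseq iter_addr addr0.
Qed.

Lemma sym_char_poly_split (R : rcfType) n (A : 'M[R]_n) :
  A^T = A -> exists s : n.-tuple R, char_poly A = \prod_(a <- s) ('X - a%:P).
Proof.
move=> symA; pose f := real_complex R; pose B := map_mx f A.
have hB : B \is hermsymmx.
  apply/is_hermitianmxP; rewrite expr0 scale1r; apply/matrixP => i j.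
  by rewrite !mxE -[in LHS]symA mxE; apply/esym/conj_Creal; rewrite complex_real.
have /orthomx_spectralP BE := hermitian_normalmx hB.
have /mxOverP rB := hermitian_spectral_diag_real hB.
set d := spectral_diag B in BE rB; set P := spectralmx B in BE.
have uP : P \in unitmx by exact: spectral_unit.
exists [tuple complex.Re (d 0 i) | i < n].
apply: (@map_poly_inj _ _ f).
rewrite map_char_poly -/B big_map rmorph_prod /= big_enum /=.
transitivity (\prod_(i < n) ('X - (d 0 i)%:P)); last first.
  by apply: eq_bigr => i _; rewrite rmorphB /= map_polyX map_polyC /= RRe_real.
pose Q := map_mx (@polyC R[i]) P; pose Q' := map_mx (@polyC R[i]) (invmx P).
have QQ : Q' *m Q = 1%:M by rewrite -map_mxM mulVmx // map_mx1.
have BQ : char_poly_mx B = Q' *m char_poly_mx (diag_mx d) *m Q.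
  rewrite /char_poly_mx mulmxBr mulmxBl scalar_mxC.
  by rewrite -[_%:M *m _ *m Q]mulmxA QQ mulmx1 [in LHS]BE !map_mxM.
rewrite /char_poly BQ !det_mulmx mulrAC -det_mulmx QQ det1 mul1r.
rewrite -/(char_poly _) char_poly_trig ?diag_mx_is_trig //.
by apply: eq_bigr => i _; rewrite mxE eqxx mulr1n.
Qed.

Lemma energyP (R : rcfType) n (A : 'M[R]_n) : A^T = A ->
  exists2 s : n.-tuple R, char_poly A = \prod_(a <- s) ('X - a%:P)
                        & energy A = \sum_(a <- s) `|a|.
Proof.
by move=> /sym_char_poly_split[s As]; exists s; rewrite // (energy_split As).
Qed.

(* Main.v *)
(** Write m(v) on the diagonal of C: since a set of edges separating u from w
    separates any third vertex from u or from w, the resulting nonnegative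
    symmetric matrix A satisfies A u w >= min (A u v) (A v w) for all u, v, w.
    Each relation "A u v >= t" with t > 0 is then a partial equivalence, whose
    indicator matrix is a sum of squares of indicators of classes, and A is a
    nonnegative combination of such indicators; hence (1).  So all eigenvalues
    of C are at least -M, and if c_vw = M, the rows of v and w agree away from v
    and w, so that e_v - e_w is an eigenvector for -M.  As C has trace 0, some
    eigenvalue L is nonnegative, and |x| <= x + 2 M for the n - 1 other
    eigenvalues x sums to the energy bound.  In case of equality with M > 0,
    these are all -M, so L = (n - 1) M; a row in which an eigenvector for L
    has maximal modulus must have all its off-diagonal entries equal to M, and
    the inequality on A then gives M for all other entries. *)
Require Import Defs.
From mathcomp Require Import all_boot all_order all_algebra.
From mathcomp Require Import ring lra.

Set Implicit Arguments.
Unset Strict Implicit.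
Unset Printing Implicit Defensive.

Import Order.TTheory GRing.Theory Num.Theory.
Local Open Scope ring_scope.

(** * Positivity of ultrametric quadratic forms *)

(** Grouping the indices by their class, each nonempty class contributes the square of the sum of
    [x] over it. Indices related to nothing share the empty class and contribute 0. *)
Lemma partial_equiv_form_ge0 (R : realDomainType) (T : finType) (r : rel T)
    (x : T -> R) :
  symmetric r -> transitive r -> 0 <= \sum_i \sum_(j | r i j) x i * x j.
Proof.
move=> rC rT; pose cls i := [set j | r i j].
rewrite (partition_big cls predT) //=; apply: sumr_ge0 => B _.
have [->|/set0Pn[k kB]] := eqVneq B set0.
  rewrite big1 // => i /eqP clsi; rewrite big_pred0 // => j.
  by have := in_set0 j; rewrite -clsi inE.
rewrite (_ : \sum_(i | _) _ = (\sum_(i | cls i == B) x i) ^+ 2) ?sqr_ge0 //.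
rewrite expr2 big_distrlr /=; apply: eq_bigr => i /eqP clsi.
apply: eq_bigl => j; have rik : r i k by rewrite -clsi inE in kB.
apply/idP/eqP => [rij | clsj]; last first.
  by rewrite -clsj inE in kB; apply: rT rik _; rewrite rC.
apply/setP => l; rewrite -clsi !inE; apply/idP/idP; first exact: rT.
by apply: rT; rewrite rC.
Qed.

Lemma ultrametric_form_ge0 (R : realDomainType) (T : finType)
    (a : T -> T -> R) (x : T -> R) :
  (forall i j, 0 <= a i j) -> (forall i j, a i j = a j i) ->
  (forall i j k, Num.min (a i j) (a j k) <= a i k) ->
  0 <= \sum_i \sum_j a i j * (x i * x j).
Proof.
have [n] := ubnP #|[pred p : T * T | 0 < a p.1 p.2]|.
elim: n a => // n IHn a; rewrite ltnS => le_n a_ge0 aC aU.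
case: (pickP [pred p : T * T | 0 < a p.1 p.2]) => [p0 /= p0_gt0|a0]; last first.
  rewrite big1 // => i _; rewrite big1 // => j _.
  have /= := a0 (i, j); rewrite lt_def a_ge0 andbT => /negbFE/eqP->.
  by rewrite mul0r.
case: (@Order.TotalTheory.arg_minP _ _ _ p0 [pred p | 0 < a p.1 p.2]
         (fun p => a p.1 p.2) p0_gt0) => p /= p_gt0 p_min.
set t := a p.1 p.2 in p_gt0 p_min.
have t_min i j : 0 < a i j -> t <= a i j by move/(p_min (i, j)).
(* Subtracting the least positive value t on the support of a preserves the
   hypotheses and shrinks the support. *)
pose r i j := 0 < a i j; pose b i j := a i j - t *+ r i j.
have aE i j : a i j = b i j + t *+ r i j by rewrite subrK.
have -> : \sum_i \sum_j a i j * (x i * x j) =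
    \sum_i \sum_j b i j * (x i * x j) + t * \sum_i \sum_(j | r i j) x i * x j.
  rewrite mulr_sumr -big_split; apply: eq_bigr => i _ /=.
  rewrite mulr_sumr [X in _ + X]big_mkcond -big_split; apply: eq_bigr => j _ /=.
  by rewrite aE mulrDl; case: (r i j); rewrite ?mul0r.
apply: addr_ge0; last first.
  apply: mulr_ge0; first exact: ltW.
  apply: partial_equiv_form_ge0 => [i j | j i k rij rjk]; first by rewrite /r aC.
  by rewrite /r (lt_le_trans _ (aU i j k)) // lt_min; apply/andP.
have b_ge0 i j : 0 <= b i j.
  rewrite /b /r; have := t_min i j.
  by have := a_ge0 i j; case: (0 < a i j) => // *; rewrite ?subr0 ?subr_ge0; auto.
apply: IHn => // [|i j|i j k]; last 2 first.
- by rewrite /b /r aC.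
(* If [u] and [v] are positive, so is [w], and all three drop by [t]. Otherwise [u] or [v] is 0 and
   stays so, while [w] remains nonnegative. *)
- have := aU i j k; have := t_min i j; have := t_min j k; have := t_min i k.
  have := a_ge0 i j; have := a_ge0 j k; have := a_ge0 i k; move: p_gt0.
  rewrite /b /r !ge_min; set u := a i j; set v := a j k; set w := a i k.
  move=> t0 w0 v0 u0 tw tv tu uvw; move: tw tv tu.
  case: (ltrP 0 w) => hw; case: (ltrP 0 v) => hv; case: (ltrP 0 u) => hu;
    move=> tw tv tu; move: uvw => /orP[] h; apply/orP;
    try (have := tw isT); try (have := tu isT); try (have := tv isT);
    rewrite /= ?mulr1n ?mulr0n => *; by [left; lra | right; lra].
apply: leq_trans le_n; apply: proper_card; apply/properP; split.
  apply/subsetP => q; rewrite !inE /b => bq; apply: lt_le_trans bq _.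
  by rewrite gerBl mulrn_wge0 // ltW.
by exists p; rewrite !inE // /b /r -/t p_gt0 subrr ltxx.
Qed.

(** * Energy of symmetric matrices of trace 0 *)

(** Up to sign, both sides are the coefficient of degree [n - 1] of the characteristic polynomial;
    for [n = 0] both are empty sums. *)
Lemma sum_prod_XsubC_trace (R : comNzRingType) n (A : 'M[R]_n) (s : n.-tuple R) :
  char_poly A = \prod_(a <- s) ('X - a%:P) -> \sum_(a <- s) a = \tr A.
Proof.
case: n => [|n] in A s *.
  by move=> _; rewrite (tuple0 s) big_nil /mxtrace big_ord0.
move=> As; apply: oppr_inj; rewrite -char_poly_trace // As.
by rewrite -coefPn_prod_XsubC size_tuple.
Qed.

Section ZeroTrace.
Variables (R : rcfType) (n : nat) (A : 'M[R]_n) (M : R).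
Hypotheses (n_gt0 : (0 < n)%N) (symA : A^T = A) (trA : \tr A = 0).
Hypothesis M_ge0 : 0 <= M.

Lemma energy_zero_trace :
  (forall b, eigenvalue A b -> - M <= b) ->
  energy A <= 2 * (n%:R - 1) * M /\
  (energy A = 2 * (n%:R - 1) * M -> 0 < M -> eigenvalue A ((n%:R - 1) * M)).
Proof.
move=> geM; have [s As ->] := energyP symA.
have eigs a : a \in s -> eigenvalue A a.
  by rewrite eigenvalue_root_char As root_prod_XsubC.
have sum_s := sum_prod_XsubC_trace As; rewrite trA in sum_s.
have [L Ls L_ge0] : exists2 a, a \in s & 0 <= a.
  apply/hasP/negPn/negP => /hasPn neg_s.
  have : \sum_(a <- s) a < \sum_(a <- s) 0.
    rewrite !big_seq; apply: ltr_sum => [|a /neg_s]; last by rewrite -ltNge.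
    by apply/hasP; exists (tnth s (Ordinal n_gt0)); rewrite mem_tnth.
  by rewrite sum_s big1 // ltxx.
have bound a : a \in rem L s -> `|a| <= a + 2 * M.
  move/mem_rem/eigs/geM; move: M_ge0; have [a_pos | a_neg] := ger0P a; lra.
have sz : size (rem L s) = n.-1 by rewrite size_rem // size_tuple.
have n1 : n.-1%:R = n%:R - 1 :> R by rewrite -subn1 natrB.
have sumM : \sum_(a <- rem L s) (a + 2 * M) + L = 2 * (n%:R - 1) * M.
  rewrite big_split /= addrAC (addrC _ L).
  rewrite (perm_big _ (perm_to_rem Ls)) big_cons in sum_s.
  rewrite sum_s add0r big_const_seq count_predT sz iter_addr addr0.
  by rewrite -[_ *+ n.-1]mulr_natr n1; ring.
rewrite (perm_big _ (perm_to_rem Ls)) big_cons /= ger0_norm // [L + _]addrC -sumM.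
split.
  by rewrite lerD2r !big_seq; apply: ler_sum => a /bound.
move=> /addIr sum_eq M_gt0; apply: eigs.
(* Equality of the sums forces equality in each [bound], and [|a| = a + 2 * M] with [0 < M] leaves
   only [a = - M]. *)
have all_M a : a \in rem L s -> a = - M.
  move=> a_s; have := sum_eq; rewrite !(perm_big _ (perm_to_rem a_s)) !big_cons /=.
  have : \sum_(b <- rem a (rem L s)) `|b| <=
         \sum_(b <- rem a (rem L s)) (b + 2 * M).
    by rewrite !big_seq; apply: ler_sum => b /mem_rem/bound.
  have := bound a a_s; have [a_pos|a_neg] := ger0P a; lra.
rewrite (perm_big _ (perm_to_rem Ls)) big_cons in sum_s.
rewrite (eq_big_seq _ all_M) big_const_seq count_predT sz in sum_s.
rewrite iter_addr addr0 -mulr_natr n1 /= in sum_s.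
by rewrite (_ : _ * M = L) //; lra.
Qed.

(* |x| is an affine function of x on the two-point set {- M, (n - 1) M}. *)
Lemma energy_two_eigenvalues :
  (forall b, eigenvalue A b -> b = - M \/ b = (n%:R - 1) * M) ->
  energy A = 2 * (n%:R - 1) * M.
Proof.
move=> eigA; have [s As ->] := energyP symA.
have sum_s := sum_prod_XsubC_trace As; rewrite trA in sum_s.
have n_neq0 : n%:R != 0 :> R by rewrite pnatr_eq0 -lt0n.
have n1 : 0 <= n%:R - 1 :> R by rewrite subr_ge0 ler1n.
transitivity (\sum_(a <- s)
  ((n%:R - 2) / n%:R * a + 2 * (n%:R - 1) * M / n%:R)).
  apply: eq_big_seq => a a_s.
  have [|->|->] := eigA a.
  - by rewrite eigenvalue_root_char As root_prod_XsubC.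
  - by rewrite normrN ger0_norm //; field.
  - by rewrite ger0_norm ?mulr_ge0 //; field.
(* The linear term drops out because the trace is 0. *)
rewrite big_split /= -mulr_sumr sum_s mulr0 add0r.
rewrite big_const_seq count_predT size_tuple iter_addr addr0.
by rewrite -[_ *+ n]mulr_natr; field.
Qed.

End ZeroTrace.

(** * Eigenvector arguments for ultrametric or constant off-diagonal entries *)

(** Multiply [v *m A = b *: v] by [v^T] on the right. This turns lower bounds on the quadratic form
    into lower bounds on eigenvalues. *)
Lemma eigenvalue_form (R : realFieldType) n (A : 'M[R]_n) (b : R) :
  eigenvalue A b ->
  exists2 x : 'cV[R]_n, 0 < \sum_i x i 0 ^+ 2
    & (x^T *m A *m x) 0 0 = b * \sum_i x i 0 ^+ 2.
Proof.
case/eigenvalueP => v vA v_neq0; exists v^T.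
  have sq_ge0 i : true -> 0 <= v^T i 0 ^+ 2 by rewrite sqr_ge0.
  rewrite lt_def sumr_ge0 // andbT psumr_eq0 //.
  apply: contraNN v_neq0 => /allP v0; apply/eqP/rowP => i; rewrite !mxE.
  by have := v0 i (mem_index_enum i); rewrite sqrf_eq0 mxE => /eqP.
rewrite trmxK vA -scalemxAl mxE; congr (_ * _).
by rewrite mxE; apply: eq_bigr => i _; rewrite mxE expr2.
Qed.

Section UltrametricMatrix.
Variables (R : realFieldType) (n : nat) (A : 'M[R]_n) (M : R).
Hypotheses (A_ge0 : forall i j, 0 <= A i j) (A_le : forall i j, A i j <= M).
Hypotheses (AC : forall i j, A i j = A j i) (A0 : forall i, A i i = 0).
Hypothesis AU : forall i j k, i != j -> j != k -> i != k ->
  Num.min (A i j) (A j k) <= A i k.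

Lemma eigenvalue_max_entry i j : i != j -> A i j = M -> eigenvalue A (- M).
Proof.
move=> ij AM; apply/eigenvalueP; exists (delta_mx 0 i - delta_mx 0 j).
  (* As [A k l] is the maximum, the minimum of [A k l] and [A l h] is [A l h]. Used in both
     directions, this makes rows [i] and [j] agree off [i] and [j]. *)
  have ge k l h : k != l -> A k l = M -> h != k -> h != l -> A l h <= A k h.
    move=> kl Akl hk hl; apply: le_trans (@AU k l h _ _ _) => //; rewrite 1?eq_sym //.
    by rewrite Akl le_min A_le lexx.
  apply/rowP => k; rewrite mulmxBl -!rowE !mxE /=.
  have [->|ki] := eqVneq k i.
    by rewrite (negPf ij) A0 AC AM /= sub0r subr0 mulr1.
  have [->|kj] := eqVneq k j; first by rewrite A0 AM /= sub0r subr0 mulrN1 opprK.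
  rewrite subrr mulr0; apply/eqP; rewrite subr_eq0; apply/eqP/le_anti.
  by rewrite !ge // ?(eq_sym j) // AC.
apply/eqP => /rowP/(_ i)/eqP; rewrite !mxE !eqxx (negPf ij) subr0.
by rewrite oner_eq0.
Qed.

Lemma eigenvalue_max_sum :
  0 < M -> eigenvalue A ((n%:R - 1) * M) -> forall i j, i != j -> A i j = M.
Proof.
move=> M_gt0 /eigenvalueP[v vA v_neq0].
have [k0 vk0] : exists k, v 0 k != 0.
  by apply/existsP; apply: contraNT v_neq0 => /existsPn v0;
     apply/eqP/rowP => k; rewrite mxE; apply/eqP; have := v0 k; rewrite negbK.
case: (@Order.TotalTheory.arg_maxP _ _ _ k0 predT (fun k => `|v 0 k|) isT)
  => k _ k_max.
have vk_gt0 : 0 < `|v 0 k| by apply: lt_le_trans (k_max k0 isT); rewrite normr_gt0.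
have term i : `|v 0 i * A i k| <= M * `|v 0 k|.
  by rewrite normrM mulrC ger0_norm // ler_pM //; exact: k_max.
(* This is the triangle inequality in coordinate [k] of the eigenvector equation. The right side has
   [n - 1] terms, each at most [M * |v 0 k|] by [term], so each attains that bound. *)
have sum_le : (n%:R - 1) * (M * `|v 0 k|) <= \sum_(i | i != k) `|v 0 i * A i k|.
  have /rowP/(_ k) := vA; rewrite !mxE (bigD1 k) //= A0 mulr0 add0r => vk.
  rewrite (le_trans _ (ler_norm_sum _ _ _)) // vk !normrM (ger0_norm (ltW M_gt0)).
  by rewrite mulrA ler_wpM2r // ler_pM2r // ler_norm.
have sum_const : \sum_(i | i != k) (M * `|v 0 k|) = (n%:R - 1) * (M * `|v 0 k|).
  rewrite sumr_const cardC1 card_ord -[LHS]mulr_natl -subn1 natrB //.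
  exact: leq_ltn_trans (ltn_ord k).
have AkM i : i != k -> A i k = M.
  move=> ik; apply/le_anti; rewrite A_le /=.
  have le_others : \sum_(j | (j != k) && (j != i)) `|v 0 j * A j k| <=
                   \sum_(j | (j != k) && (j != i)) (M * `|v 0 k|).
    exact: ler_sum.
  move: sum_le; rewrite -sum_const !(bigD1 i ik) /= => sum_le.
  have : M * `|v 0 k| <= `|v 0 i * A i k| by lra.
  rewrite normrM [`|A i k|]ger0_norm // mulrC => h.
  rewrite -(ler_pM2l vk_gt0) (le_trans h) // ler_wpM2r //; exact: k_max.
move=> i j ij; have [ik|ik] := eqVneq i k; first by rewrite ik AC AkM // -ik eq_sym.
have [jk|jk] := eqVneq j k; first by rewrite jk AkM // -jk.
apply/le_anti; rewrite A_le /= (le_trans _ (@AU i k j _ _ _)) // 1?eq_sym //.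
by rewrite (AC k j) !AkM // minxx.
Qed.

End UltrametricMatrix.

(** With [S] the coordinate sum of an eigenvector, each coordinate satisfies
    [(b + M) * v 0 k = M * S]. If [b] is not [- M], then [S] is nonzero, and summing over [k] gives
    [b + M = n * M]. *)
Lemma eigenvalue_uniform (R : fieldType) n (A : 'M[R]_n) (M b : R) :
  (forall i, A i i = 0) -> (forall i j, i != j -> A i j = M) ->
  eigenvalue A b -> b = - M \/ b = (n%:R - 1) * M.
Proof.
move=> A0 AM /eigenvalueP[v vA v_neq0].
pose S := \sum_i v 0 i.
have vE k : (b + M) * v 0 k = M * S.
  have /rowP/(_ k) := vA; rewrite !mxE (bigD1 k) //= A0 mulr0 add0r.
  rewrite (eq_bigr (fun i => v 0 i * M)) => [|i ik]; last by rewrite AM.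
  by rewrite -mulr_suml mulrDl => <-; rewrite /S [in RHS](bigD1 k) //=; ring.
have [bM|bM] := eqVneq (b + M) 0; first by left; apply/eqP; rewrite -addr_eq0 bM.
right; have S_neq0 : S != 0.
  apply: contraNneq v_neq0 => S0; apply/eqP/rowP => k; rewrite mxE.
  by apply/eqP; have := vE k; rewrite S0 mulr0 => /eqP; rewrite mulf_eq0 (negPf bM).
apply: (addIr M); apply: (mulIf S_neq0).
rewrite {1}/S mulr_sumr (eq_bigr _ (fun k _ => vE k)) sumr_const card_ord.
by rewrite -mulr_natl; ring.
Qed.

(** * Edge connectivities and their matrix *)

Section EdgeConnectivity.
Variables (R : realDomainType) (V : finType) (G : wgraph R V).
Implicit Types (u v w : V) (F : {set {set V}}).

Lemma connect_adjC F : connect_sym (adj F).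
Proof. by apply: sym_connect_sym => x y; rewrite /adj /= setUC. Qed.

Lemma edge_connC v w : edge_conn G v w = edge_conn G w v.
Proof.
rewrite /edge_conn eq_sym; case: eqP => // _; apply: eq_bigl => F.
by rewrite /disconnects connect_adjC.
Qed.

Lemma edge_conn_ge0 v w : 0 <= edge_conn G v w.
Proof.
have ge0 F : F \subset edges G -> 0 <= total_weight G F.
  by move/subsetP => FE; apply: sumr_ge0 => e /FE; apply: weight_ge0.
rewrite /edge_conn; case: eqP => // _; apply/bigmin_geP.
by split=> [|F /andP[/ge0]//]; apply: ge0.
Qed.

Lemma edge_connU u v w : u != v -> v != w -> u != w ->
  Num.min (edge_conn G u v) (edge_conn G v w) <= edge_conn G u w.
Proof.
rewrite /edge_conn => /negPf-> /negPf-> /negPf->; apply/bigmin_geP; split.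
  (* The default value, the weight of all edges, bounds each of the minima from above. *)
  by rewrite ge_min bigmin_le_id.
move=> F /andP[FE nuw]; rewrite ge_min.
have [uv|nuv] := boolP (connect (adj (edges G :\: F)) u v); last first.
  by rewrite bigmin_le_cond // /disconnects FE.
have [vw|nvw] := boolP (connect (adj (edges G :\: F)) v w); last first.
  by rewrite orbC bigmin_le_cond // /disconnects FE.
by rewrite (connect_trans uv vw) in nuw.
Qed.

Lemma max_row_ge v w : w != v -> edge_conn G v w <= max_row G v.
Proof. by move=> wv; apply: (le_bigmax_cond _ (edge_conn G v)). Qed.

Lemma max_row_ge0 v : 0 <= max_row G v.
Proof. exact: bigmax_ge_id. Qed.

Lemma max_conn_ge0 : 0 <= max_conn G.
Proof. exact: bigmax_ge_id. Qed.

Lemma max_conn_ge v w : edge_conn G v w <= max_conn G.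
Proof.
exact: (le_bigmax _ (fun vw => edge_conn G vw.1 vw.2) (v, w)).
Qed.

Lemma max_row_le_max_conn v : max_row G v <= max_conn G.
Proof.
by apply/bigmax_leP; split=> [|w _]; [exact: max_conn_ge0 | exact: max_conn_ge].
Qed.

(** Entries are nonnegative and a vertex [v] supplies the pair [(v, v)], so the default 0 never
    exceeds all entries. *)
Lemma max_conn_attained : (0 < #|V|)%N ->
  exists vw : V * V, edge_conn G vw.1 vw.2 = max_conn G.
Proof.
case/card_gt0P => v _.
have [//|vw _|vw _ vwE] := eq_bigmax (x := 0) (v, v) xpredT
  (fun vw => edge_conn G vw.1 vw.2).
- exact: edge_conn_ge0.
- by exists vw; rewrite -vwE.
Qed.

Lemma conn_mxC i j : conn_mx G i j = conn_mx G j i.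
Proof. by rewrite !mxE edge_connC. Qed.

Lemma tr_conn_mx : (conn_mx G)^T = conn_mx G.
Proof. by apply/matrixP => i j; rewrite mxE conn_mxC. Qed.

Lemma conn_mx_diag i : conn_mx G i i = 0.
Proof. by rewrite mxE /edge_conn eqxx. Qed.

Lemma conn_mxU i j k : i != j -> j != k -> i != k ->
  Num.min (conn_mx G i j) (conn_mx G j k) <= conn_mx G i k.
Proof. by move=> *; rewrite !mxE edge_connU ?(inj_eq enum_val_inj). Qed.

Lemma mxtrace_conn_mx : \tr (conn_mx G) = 0.
Proof. by rewrite /mxtrace big1 // => i _; rewrite conn_mx_diag. Qed.

Lemma psdmx_conn_max_row : psdmx (conn_mx G + max_row_mx G).
Proof.
have BE i j : (conn_mx G + max_row_mx G) i j =
    if i == j then max_row G (enum_val i)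
    else edge_conn G (enum_val i) (enum_val j).
  rewrite !mxE; case: eqVneq => [<-|_]; last by rewrite mulr0n addr0.
  by rewrite /edge_conn eqxx add0r mulr1n.
split=> [|x]; first by rewrite linearD /= tr_conn_mx tr_diag_mx.
set B := _ + _ in BE *.
have -> : (x^T *m B *m x) 0 0 = \sum_j \sum_i B j i * (x j 0 * x i 0).
  rewrite mxE exchange_big; apply: eq_bigr => j _; rewrite mxE mulr_suml.
  by apply: eq_bigr => i _; rewrite !mxE; ring.
apply: (@ultrametric_form_ge0 _ _ B (fun i => x i 0)) => [i j|i j|i j k].
- by rewrite BE; case: ifP; rewrite ?max_row_ge0 ?edge_conn_ge0.
- by rewrite !BE eq_sym edge_connC; case: eqP => // ->.
have neq i' j' : i' != j' -> enum_val i' != enum_val j' :> V.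
  by rewrite (inj_eq enum_val_inj).
rewrite !BE; have [<-|ij] := eqVneq i j; first by rewrite ge_min lexx orbT.
have [<-|jk] := eqVneq j k; first by rewrite (negPf ij) ge_min lexx.
have [_|ik] := eqVneq i k; last by apply: edge_connU; apply: neq.
(* The case [i = k] is what the diagonal [max_row] is for: it dominates the rest of its row. *)
by rewrite ge_min max_row_ge // neq // eq_sym.
Qed.

End EdgeConnectivity.

(** * Spectrum and energy of the connectivity matrix *)

Lemma conn_mx_eigenvalue_ge (R : realFieldType) (V : finType) (G : wgraph R V) b :
  eigenvalue (conn_mx G) b -> - max_conn G <= b.
Proof.
case/eigenvalue_form => x x_gt0 xCx.
have [_ /(_ x)] := psdmx_conn_max_row G.
rewrite mulmxDr mulmxDl mxE xCx mxE => ge0.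
rewrite -(ler_pM2r x_gt0) mulNr lerNl -subr_ge0 opprK addrC.
apply: le_trans ge0 _; rewrite lerD2l mulr_sumr; apply: ler_sum => i _.
rewrite mul_mx_diag !mxE mulrAC -expr2 mulrC ler_wpM2r ?sqr_ge0 //.
exact: max_row_le_max_conn.
Qed.

Lemma conn_mx_eigenvalue_min (R : realFieldType) (V : finType) (G : wgraph R V) :
  (0 < #|V|)%N -> eigenvalue (conn_mx G) (- max_conn G).
Proof.
(* A zero maximum may be attained only on the diagonal, as for a single vertex, but then the matrix
   vanishes. A positive maximum is attained off the diagonal. *)
move=> V_gt0; have := max_conn_ge0 G; rewrite le_eqVlt => /predU1P[M0|M_gt0].
  have C0 : conn_mx G = 0.
    apply/matrixP => i j; rewrite !mxE; apply/le_anti.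
    by rewrite {1}M0 max_conn_ge edge_conn_ge0.
  apply/eigenvalueP; exists (delta_mx 0 (Ordinal V_gt0)).
    by rewrite C0 -M0 oppr0 mulmx0 scale0r.
  by apply/eqP => /rowP/(_ (Ordinal V_gt0))/eqP; rewrite !mxE !eqxx oner_eq0.
have [[v w] /= vw] := max_conn_attained G V_gt0.
have v_neq_w : v != w.
  by apply: contraTneq M_gt0 => v_w; rewrite -vw v_w /edge_conn eqxx ltxx.
apply: (@eigenvalue_max_entry _ _ _ _ _ _ _ _ (enum_rank v) (enum_rank w)).
- by move=> i j; rewrite mxE max_conn_ge.
- exact: conn_mxC.
- exact: conn_mx_diag.
- exact: conn_mxU.
- by rewrite (inj_eq enum_rank_inj).
- by rewrite mxE !enum_rankK.
Qed.

Theorem theorem1 (R : rcfType) (V : finType) (G : wgraph R V)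
    (V_gt0 : (0 < #|V|)%N) :
  [/\ psdmx (conn_mx G + max_row_mx G),
      smallest_eigenvalue (conn_mx G) (- max_conn G),
      energy (conn_mx G) <= 2 * (#|V|%:R - 1) * max_conn G
    & energy (conn_mx G) = 2 * (#|V|%:R - 1) * max_conn G <->
      uniformly_edge_connected G (max_conn G)].
Proof.
have M_ge0 := max_conn_ge0 G.
have [energy_le energy_eq] := energy_zero_trace V_gt0 (tr_conn_mx G)
  (mxtrace_conn_mx G) M_ge0 (@conn_mx_eigenvalue_ge _ _ G).
split=> //; first exact: psdmx_conn_max_row.
  by split; [exact: conn_mx_eigenvalue_min | exact: conn_mx_eigenvalue_ge].
split=> [/energy_eq eig v w vw | unif]; last first.
  apply: energy_two_eigenvalues; rewrite ?tr_conn_mx ?mxtrace_conn_mx // => b.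
  apply: eigenvalue_uniform => [i|i j ij]; first exact: conn_mx_diag.
  by rewrite mxE unif // (inj_eq enum_val_inj).
(* If the maximum is not positive, every connectivity is squeezed between 0 and it. *)
have [M_gt0|M_le0] := ltrP 0 (max_conn G); last first.
  by apply/le_anti; rewrite max_conn_ge (le_trans M_le0) // edge_conn_ge0.
rewrite -(enum_rankK v) -(enum_rankK w).
have := @eigenvalue_max_sum _ _ _ _ _ _ _ _ _ M_gt0 (eig M_gt0)
  (enum_rank v) (enum_rank w).
rewrite mxE; apply; last by rewrite (inj_eq enum_rank_inj).
- by move=> i j; rewrite mxE edge_conn_ge0.
- by move=> i j; rewrite mxE max_conn_ge.
- exact: conn_mxC.
- exact: conn_mx_diag.
- exact: conn_mxU.
Qed.
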